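(* For every integer $n\ge 1$, the number of oriented Riordan graphs on $n$ vertices, i.e. the number of distinct graphs $G_n^\sigma(g,f)$ on the labelled vertex set $\{1,\dots,n\}$ (equivalently, of distinct skew-adjacency matrices $\mathcal{S}(G_n^\sigma(g,f))$) as $(g,f)$ ranges over all pairs $g,f\in\mathbb{Z}[[z]]$ with $f(0)=0$, is $$\frac{3^{2(n-1)}+3}{4}.$$
   Context: An oriented graph is a directed graph without loops and without symmetric pairs of arcs. The skew-adjacency matrix of an oriented graph $G^\sigma$ on vertex set $\{1,\dots,n\}$ is the matrix $\mathcal{S}(G^\sigma)=[s_{i,j}]_{1\le i,j\le n}$ with $s_{i,j}=1$ and $s_{j,i}=-1$ if $i\to j$ is an arc, and $s_{i,j}=s_{j,i}=0$ if there is no arc between $i$ and $j$. For $g,f\in\mathbb{Z}[[z]]$ with $f(0)=0$ and $n\ge1$, the oriented Riordan graph $G_n^\sigma(g,f)$ is the oriented graph on $\{1,\dots,n\}$ whose skew-adjacency matrix $[s_{i,j}]$ has entries in $\{-1,0,1\}$ and satisfies $s_{i,j}\equiv [z^{i-2}]\,g f^{\,j-1}\pmod 3$ for $i>j$, $s_{j,i}=-s_{i,j}$, and $s_{i,i}=0$. Here $[z^k]h$ denotes the coefficient of $z^k$ in $h$. *)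

(* Defs.v *)
From HB Require Import structures.
From mathcomp Require Import all_boot all_order all_algebra.
From mathcomp Require Import boolp.

Set Implicit Arguments.
Unset Strict Implicit.
Unset Printing Implicit Defensive.

Import GRing.Theory.
Local Open Scope ring_scope.

(* Formal power series.  A record around [nat -> R] is used because functions
   already carry the pointwise ring structure, whereas [*] has to be the Cauchy
   product here. *)
Record fps (R : comNzRingType) := Fps { fps_coef : nat -> R }.

Notation "{ 'fps' R }" := (fps R) (at level 0, format "{ 'fps'  R }").
Notation "[ 'z^' k ] h" := (fps_coef h k)
  (at level 10, k at level 99, h at level 9, format "[ 'z^'  k ]  h").

HB.instance Definition _ (R : comNzRingType) := gen_eqMixin {fps R}.
HB.instance Definition _ (R : comNzRingType) := gen_choiceMixin {fps R}.

Section FpsRing.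
Variable R : comNzRingType.
Implicit Types a b c : {fps R}.

Lemma fpsP a b : (forall k, [z^ k] a = [z^ k] b) -> a = b.
Proof. by case: a b => [a] [b] /= /funext ->. Qed.

Definition fps_zero : {fps R} := Fps (fun _ => 0).
Definition fps_one : {fps R} := Fps (fun k => (k == 0%N)%:R).
Definition fps_opp a : {fps R} := Fps (fun k => - [z^ k] a).
Definition fps_add a b : {fps R} := Fps (fun k => [z^ k] a + [z^ k] b).
Definition fps_mul a b : {fps R} :=
  Fps (fun k => \sum_(i < k.+1) [z^ i] a * [z^ k - i] b).

Fact fps_addA : associative fps_add.
Proof. by move=> a b c; apply: fpsP => k /=; rewrite addrA. Qed.
Fact fps_addC : commutative fps_add.
Proof. by move=> a b; apply: fpsP => k /=; rewrite addrC. Qed.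
Fact fps_add0 : left_id fps_zero fps_add.
Proof. by move=> a; apply: fpsP => k /=; rewrite add0r. Qed.
Fact fps_addN : left_inverse fps_zero fps_opp fps_add.
Proof. by move=> a; apply: fpsP => k /=; rewrite addNr. Qed.

HB.instance Definition _ := GRing.isZmodule.Build {fps R}
  fps_addA fps_addC fps_add0 fps_addN.

Definition fps_trunc (m : nat) a : {poly R} := \poly_(i < m) [z^ i] a.

Lemma coef_fps_mul_trunc m a b k : (k < m)%N ->
  [z^ k] (fps_mul a b) = (fps_trunc m a * fps_trunc m b)`_k.
Proof.
move=> lt_km; rewrite coefM; apply: eq_bigr => i _; rewrite !coef_poly.
by rewrite (leq_ltn_trans (leq_ord i)) // (leq_ltn_trans (leq_subr _ _)).
Qed.

Fact fps_mulC : commutative fps_mul.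
Proof.
by move=> a b; apply: fpsP => k; rewrite !(coef_fps_mul_trunc _ _ (ltnSn k)) mulrC.
Qed.

Fact fps_mulA : associative fps_mul.
Proof.
move=> a b c; apply: fpsP => k.
pose T := fps_trunc k.+1.
transitivity (T a * (T b * T c))`_k.
  rewrite coefM; apply: eq_bigr => i _.
  by rewrite coef_poly ltn_ord -coef_fps_mul_trunc // ltnS leq_subr.
rewrite mulrA coefM; apply: eq_bigr => i _.
by rewrite -coef_fps_mul_trunc // coef_poly ltnS leq_subr.
Qed.

Fact fps_mul1 : left_id fps_one fps_mul.
Proof.
move=> a; apply: fpsP => k /=.
by rewrite big_ord_recl mul1r subn0 big1 ?addr0 // => i _; rewrite mul0r.
Qed.

Fact fps_mulDl : left_distributive fps_mul fps_add.
Proof.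
move=> a b c; apply: fpsP => k /=.
by rewrite -big_split; apply: eq_bigr => i _; rewrite mulrDl.
Qed.

Fact fps_one_neq0 : fps_one != 0 :> {fps R}.
Proof.
apply/eqP => /(congr1 (fun a => [z^ 0] a)) /eqP.
by rewrite /= oner_eq0.
Qed.

HB.instance Definition _ := GRing.Zmodule_isComNzRing.Build {fps R}
  fps_mulA fps_mulC fps_mul1 fps_mulDl fps_one_neq0.

End FpsRing.

(* The vertex set {1, ..., n} is encoded by 'I_n; see [label]. *)
Definition is_oriented (n : nat) (A : {set 'I_n * 'I_n}) : bool :=
  [forall i, (i, i) \notin A] &&
  [forall i, forall j, ((i, j) \in A) ==> ((j, i) \notin A)].

Record orgraph (n : nat) := OrGraph {
  arcs : {set 'I_n * 'I_n};
  arcs_oriented : is_oriented arcs }.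

HB.instance Definition _ (n : nat) := [isSub for @arcs n].
HB.instance Definition _ (n : nat) := [Finite of orgraph n by <:].

Definition label (n : nat) (i : 'I_n) : nat := i.+1.

Definition skew_adj (n : nat) (G : orgraph n) : 'M[int]_n :=
  \matrix_(i, j) if (i, j) \in arcs G then 1
                 else if (j, i) \in arcs G then -1 else 0.

(* [G] is the oriented Riordan graph of [(g, f)].  That the entries of
   [skew_adj G] lie in {-1, 0, 1} and that it is skew-symmetric with zero
   diagonal hold for every oriented graph, so only the congruences below the
   diagonal remain; there [label i >= 2] and [label j >= 1], and the natural
   number subtractions are exact. *)
Definition is_riordan_of (n : nat) (g f : {fps int}) (G : orgraph n) : Prop :=
  forall i j : 'I_n, (label j < label i)%N ->
    (skew_adj G i j = [z^ label i - 2] (g * f ^+ (label j - 1)) %[mod 3])%Z.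

Lemma in_arcs_sym (n : nat) (G : orgraph n) i j :
  (i, j) \in arcs G -> (j, i) \notin arcs G.
Proof.
by move=> ij; case/andP: (arcs_oriented G) => _ /forallP /(_ i) /forallP /(_ j) /implyP; apply.
Qed.

Lemma arcs_irr (n : nat) (G : orgraph n) i : (i, i) \in arcs G = false.
Proof. by apply/negbTE; case/andP: (arcs_oriented G) => /forallP. Qed.

Lemma skew_adj_anti (n : nat) (G : orgraph n) i j :
  skew_adj G j i = - skew_adj G i j.
Proof.
rewrite !mxE; case: ifP => [/in_arcs_sym/negbTE ->|_] //.
by case: ifP; rewrite ?oppr0.
Qed.

Lemma skew_adj_inj (n : nat) : injective (@skew_adj n).
Proof.
move=> G H eqGH; apply: val_inj; apply/setP => -[i j] /=.
have := congr1 (fun A : 'M_n => A i j) eqGH; rewrite !mxE.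
by case: (_ \in arcs G); case: (_ \in arcs H); do ?case: ifP.
Qed.

Lemma riordan_exists_unique (n : nat) (g f : {fps int}) :
  exists! G : orgraph n, is_riordan_of g f G.
Proof.
pose c (i j : 'I_n) := [z^ label i - 2] (g * f ^+ (label j - 1)).
pose A := [set u : 'I_n * 'I_n | (u.2 < u.1)%N && (c u.1 u.2 == 1 %[mod 3])%Z
                 || (u.1 < u.2)%N && (c u.2 u.1 == -1 %[mod 3])%Z].
have A_or : is_oriented A.
  apply/andP; split; first by apply/forallP => i; rewrite inE /= ltnn.
  apply/forallP => i; apply/forallP => j; apply/implyP; rewrite !inE /=.
  case: ltngtP => //= _; last by move=> /eqP ->.
  by rewrite orbF => /eqP ->.
have mod3 (x : int) : [\/ (x %% 3)%Z = 0, (x %% 3)%Z = 1 | (x %% 3)%Z = 2].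
  have := ltz_pmod x (isT : 0 < 3 :> int); have := modz_ge0 x (isT : 3 != 0 :> int).
  case: (x %% 3)%Z => [[|[|[|k]]]|k] // _ _;
    [exact: Or31|exact: Or32|exact: Or33].
exists (OrGraph A_or); split=> [i j|G HG].
  rewrite /label ltnS => lt_ji; rewrite mxE !inE /= lt_ji (ltnNge i) (ltnW lt_ji) /= orbF.
  rewrite -/(c i j); case: (mod3 (c i j)) => ->; by [].
apply: skew_adj_inj; apply/matrixP => i j.
wlog lt_ji : i j / (j < i)%N => [hw|].
  case: (ltngtP j i) => [/hw // | /hw e | /val_inj ->].
    by rewrite skew_adj_anti e -skew_adj_anti.
  by rewrite !mxE !arcs_irr.
have := HG i j; rewrite ltnS => /(_ lt_ji) eqc.
rewrite [LHS]mxE !inE /= lt_ji (ltnNge i) (ltnW lt_ji) /= orbF.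
by rewrite /c -eqc mxE; case: ((i, j) \in arcs G); case: ((j, i) \in arcs G).
Qed.

Definition is_riordan (n : nat) (G : orgraph n) : Prop :=
  exists g f : {fps int}, [z^ 0] f = 0 /\ is_riordan_of g f G.

(* Main.v *)
(* Put N = n - 1.  A Riordan graph is determined by its first two columns, i.e.
   by the pair (g, h) with h = g f, modulo (3, z^N): if (g, gf) and (g', g'f')
   agree, then so do g f^k and g' f'^k.  A pair (g, h) arises in this way iff h
   vanishes up to and including the first nonzero coefficient of g (power series
   division over F_3).  If c(N) is the number of such pairs, splitting on the
   constant coefficient of g gives c(N+1) = 2 * 9^N + c(N) with c(0) = 1. *)
Require Import Defs.
From mathcomp Require Import all_boot all_order all_algebra.
From mathcomp Require Import boolp.
From mathcomp Require Import ring.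

Set Implicit Arguments.
Unset Strict Implicit.
Unset Printing Implicit Defensive.

Import GRing.Theory.

Local Open Scope ring_scope.

(** * Power series: congruence modulo z^N, shift and coefficient maps *)

Section PowerSeries.
Variable R : comNzRingType.
Implicit Types a b g f q : {fps R}.

Lemma coef_fpsM a b k : [z^ k] (a * b) = \sum_(i < k.+1) [z^ i] a * [z^ k - i] b.
Proof. by []. Qed.

Lemma coef0_fpsM a b : [z^ 0] (a * b) = [z^ 0] a * [z^ 0] b.
Proof. by rewrite coef_fpsM big_ord1. Qed.

Definition fps_eqmod N a b := forall k, (k < N)%N -> [z^ k] a = [z^ k] b.

Lemma fps_eqmod_mul N a b c d :
  fps_eqmod N a b -> fps_eqmod N c d -> fps_eqmod N (a * c) (b * d).
Proof.
move=> eq_ab eq_cd k lt_kN; rewrite !coef_fpsM; apply: eq_bigr => i _.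
rewrite eq_ab ?eq_cd //; first exact: leq_ltn_trans (leq_subr _ _) lt_kN.
exact: leq_ltn_trans (leq_ord i) lt_kN.
Qed.

(* [g f^(k+1) = (g f) f^k = (g' f') f^k = (g f^k) f' = (g' f'^k) f'], so no
   division by [g] is needed. *)
Lemma fps_eqmod_riordan N g f g' f' k :
    fps_eqmod N g g' -> fps_eqmod N (g * f) (g' * f') ->
  fps_eqmod N (g * f ^+ k) (g' * f' ^+ k).
Proof.
move=> eq_g eq_gf; elim: k => [|k IHk]; first by rewrite !expr0 !mulr1.
have step1 : fps_eqmod N (g * f * f ^+ k) (g' * f' * f ^+ k).
  exact: fps_eqmod_mul.
have step2 : fps_eqmod N (g' * f ^+ k) (g' * f' ^+ k).
  move=> m lt_mN; rewrite -IHk //; apply: (fps_eqmod_mul _ _ lt_mN) => // l ltl.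
  by rewrite eq_g.
have step3 : fps_eqmod N (g' * f ^+ k * f') (g' * f' ^+ k * f').
  exact: fps_eqmod_mul.
move=> m lt_mN; rewrite !exprS.
have := step1 _ lt_mN; rewrite -mulrA => ->.
by rewrite -mulrA mulrCA mulrC step3 // -mulrA [f' * _]mulrC.
Qed.

Definition fps_shift a : {fps R} :=
  Fps (fun k => if k is k'.+1 then [z^ k'] a else 0).

Lemma coef_fps_shiftM a b k : [z^ k.+1] (fps_shift a * b) = [z^ k] (a * b).
Proof. by rewrite !coef_fpsM big_ord_recl mul0r add0r. Qed.

End PowerSeries.

Section MapFps.
Variables (R S : comNzRingType) (phi : {rmorphism R -> S}).

Definition fps_map (a : {fps R}) : {fps S} := Fps (fun k => phi ([z^ k] a)).

Lemma fps_mapM a b : fps_map (a * b) = fps_map a * fps_map b.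
Proof.
apply: fpsP => k; rewrite coef_fpsM /= rmorph_sum.
by apply: eq_bigr => i _; rewrite rmorphM.
Qed.

Lemma fps_mapX a n : fps_map (a ^+ n) = fps_map a ^+ n.
Proof.
elim: n => [|n IHn]; last by rewrite !exprS fps_mapM IHn.
by apply: fpsP => k /=; rewrite rmorph_nat.
Qed.

End MapFps.

(** The coefficients of [f] are solved for one at a time: [z^N](g f) is g(0) [z^N] f plus terms in
    lower coefficients of [f], and g(0) is invertible. *)
Lemma fps_div_trunc (F : fieldType) (g q : {fps F}) N : [z^ 0] g != 0 ->
  exists f : {fps F}, fps_eqmod N (g * f) q.
Proof.
move=> g0; elim: N => [|N [f eq_f]]; first by exists 0.
pose c := ([z^ N] q - \sum_(i < N) [z^ i.+1] g * [z^ N - i.+1] f) / [z^ 0] g.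
exists (Fps (fun k => if (k < N)%N then [z^ k] f else c)) => m.
rewrite ltnS leq_eqVlt => /predU1P[-> | lt_mN].
  rewrite coef_fpsM big_ord_recl /= subn0 ltnn mulrC divfK //.
  rewrite [X in _ + X](eq_bigr (fun i : 'I_N => [z^ i.+1] g * [z^ N - i.+1] f)).
    by rewrite subrK.
  move=> [[|i] lt_iN] _ /=; first by rewrite /bump /= addn0 ltn_subrL lt_iN.
  by rewrite /bump /= ltn_subrL (leq_ltn_trans _ lt_iN).
rewrite -eq_f // !coef_fpsM; apply: eq_bigr => i _ /=.
by rewrite (leq_ltn_trans (leq_subr _ _) lt_mN).
Qed.

(* [s] lists the pairs of coefficients of [(g, h)], where [h = g * f] modulo
   [z^(size s)] for some [f] with [f(0) = 0]. *)
Fixpoint riordan_columns (F : fieldType) (s : seq (F * F)) : bool :=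
  if s is (a, b) :: s' then (b == 0) && ((a != 0) || riordan_columns s')
  else true.

(** * Admissible pairs of columns over a field and their number *)

Section RiordanColumns.
Variable F : fieldType.
Implicit Types s : seq (F * F).

(** If [g 0 = 0], dropping the first term of both sequences preserves the hypothesis; otherwise the
    test stops there. *)
Lemma riordan_columns_mkseq (g h : nat -> F) N :
    (forall m, (forall l, (l < m)%N -> g l = 0) -> h m = 0) ->
  riordan_columns (mkseq (fun m => (g m, h m)) N).
Proof.
elim: N g h => [//|N IHN] g h hg0.
rewrite /mkseq /= hg0 // eqxx /=; case: eqP => //= g0.
rewrite -[1%N]addn0 iotaDl -map_comp.
apply: (IHN (g \o succn) (h \o succn)) => m g_lt_m.
by apply: hg0 => -[//|l]; rewrite ltnS; apply: g_lt_m.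
Qed.

(** Leading zeros of [g] are peeled off as factors z, which leave [f] unchanged; at the first
    nonzero [a], truncated division applies. *)
Lemma riordan_columnsP s : riordan_columns s ->
  exists g f : {fps F}, [z^ 0] f = 0 /\
    forall m, (m < size s)%N -> nth 0 s m = ([z^ m] g, [z^ m] (g * f)).
Proof.
elim: s => [|[a b] s IHs]; first by exists 0, 0.
case/andP => /eqP -> good_s; have [a0 | a0] := eqVneq a 0; last first.
  pose g : {fps F} := Fps (fun k => (nth 0 ((a, 0) :: s) k).1).
  pose q : {fps F} := Fps (fun k => (nth 0 ((a, 0) :: s) k).2).
  have [f eq_f] := @fps_div_trunc F g q (size s).+1 a0.
  exists g, f; split=> [|m lt_m]; last by rewrite eq_f // [LHS]surjective_pairing.
  (* Comparing constant coefficients gives a f(0) = 0. *)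
  by have /eqP := eq_f 0 isT; rewrite coef0_fpsM mulf_eq0 (negPf a0) => /eqP.
move: good_s; rewrite a0 eqxx => /IHs[g [f [f0 gf]]].
exists (fps_shift g), f; split=> // -[_|m lt_m].
  by rewrite coef0_fpsM mul0r.
by rewrite coef_fps_shiftM; apply: gf.
Qed.

End RiordanColumns.

(** Solves c(N+1) = c(N) + (q - 1) q^(2N), c(0) = 1, for q = [#|F|]; the factor q + 1 stays on the
    left to avoid division in [nat]. *)
Lemma card_riordan_columns (F : finFieldType) N :
  (#|[set t : N.-tuple (F * F) | riordan_columns t]| * (#|F| + 1)
    = #|F| ^ (2 * N) + #|F|)%N.
Proof.
have cardE M : #|[set t : M.-tuple (F * F) | riordan_columns t]|
    = (\sum_(t : M.-tuple (F * F)) riordan_columns t)%N.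
  rewrite cardsE -sum1_card big_mkcond; apply: eq_bigr => t _.
  by rewrite unfold_in; case: ifP.
rewrite cardE; elim: N => [|N IHN].
  rewrite (eq_bigr (fun=> 1%N)) ?sum1_card ?card_tuple //.
    by rewrite expn0 mul1n addnC.
  by move=> t _; rewrite tuple0.
have q_gt0 : (0 < #|F|)%N by apply/card_gt0P; exists 0.
(* The head is either (0, 0), followed by an admissible tail, or one of the q - 1 pairs (a, 0) with
   a nonzero, followed by any tail. *)
suff -> : (\sum_(t : N.+1.-tuple (F * F)) riordan_columns t =
    \sum_(t : N.-tuple (F * F)) riordan_columns t
      + (#|F| - 1) * #|F| ^ (2 * N))%N.
  rewrite mulnDl IHN mulnS expnD; move: (_ ^ (2 * N))%N => Q.
  by case: #|F| q_gt0 => // q _; rewrite subn1 /=; ring.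
pose cons (p : F * (F * N.-tuple (F * F))) := [tuple of (p.1, p.2.1) :: p.2.2].
rewrite (reindex cons) /cons /=; last first.
  exists (fun t => ((thead t).1, ((thead t).2, [tuple of behead t]))).
    by move=> [a [b t]] _ /=; congr (_, (_, _)); apply: val_inj.
  by move=> t _ /=; rewrite [RHS]tuple_eta -surjective_pairing.
rewrite -(pair_bigA _ (fun a (p : F * N.-tuple (F * F)) =>
  (p.1 == 0) && ((a != 0) || riordan_columns p.2) : nat)) /=.
under eq_bigr => a _ do
  rewrite -(pair_bigA _ (fun (b : F) (t : N.-tuple (F * F)) =>
    (b == 0) && ((a != 0) || riordan_columns t) : nat)) /=.
rewrite (eq_bigr (fun a : F =>
    (\sum_(t : N.-tuple (F * F)) ((a != 0%R) || riordan_columns t))%N)); last first.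
  move=> a _; rewrite (bigD1 0) //= eqxx /=.
  rewrite [X in (_ + X)%N]big1 ?addn0 // => b /negPf->.
  by rewrite big1.
rewrite (bigD1 0) //= eqxx; congr (_ + _)%N.
rewrite (eq_bigr (fun=> #|F| ^ (2 * N))%N) => [|a ->].
  rewrite sum_nat_const; congr (_ * _)%N.
  by rewrite (cardC1 (0 : F)) subn1.
by rewrite /= sum1_card card_tuple card_prod mulnn -expnM.
Qed.

(** * Reduction modulo 3 and the first two columns of a graph *)

Lemma eqz_mod3 (x y : int) : (x = y %[mod 3])%Z <-> x%:~R = y%:~R :> 'F_3.
Proof.
have := dvdz_pcharf (pchar_Fp (isT : prime 3)) (x - y).
rewrite -eqz_mod_dvd rmorphB /= subr_eq0 => e.
by split=> [/eqP|/eqP]; [rewrite e|rewrite -e] => /eqP.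
Qed.

Notation red3 := (fps_map (intr : int -> 'F_3)).

Lemma red3_surj (a : {fps 'F_3}) : exists b : {fps int}, red3 b = a.
Proof.
exists (Fps (fun k => ([z^ k] a : nat)%:Z)); apply: fpsP => k /=.
by rewrite -pmulrn natr_Zp.
Qed.

Lemma is_riordan_ofE n (g f : {fps int}) (G : orgraph n) :
  is_riordan_of g f G <-> forall i j : 'I_n, (j < i)%N ->
    (skew_adj G i j)%:~R = [z^ i.-1] (red3 g * red3 f ^+ j).
Proof.
have red (i j : 'I_n) : ([z^ label i - 2] (g * f ^+ (label j - 1)))%:~R
    = [z^ i.-1] (red3 g * red3 f ^+ j) :> 'F_3.
  by rewrite -fps_mapX -fps_mapM /= /label subSS !subn1.
split=> HG i j lt_ji; first by rewrite -red; apply/eqz_mod3; apply: HG.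
by apply/eqz_mod3; rewrite red HG.
Qed.

(** Entry [m] belongs to the row of vertex m + 2. If [N = 0], [inord 1] is a default value, but the
    tuple is then empty. *)
Definition first_columns N (G : orgraph N.+1) : N.-tuple ('F_3 * 'F_3) :=
  [tuple ((skew_adj G (lift ord0 m) ord0)%:~R,
          (skew_adj G (lift ord0 m) (inord 1))%:~R) | m < N].

Lemma tnth_first_columns N (g f : {fps int}) (G : orgraph N.+1) m :
    [z^ 0] f = 0 -> is_riordan_of g f G ->
  tnth (first_columns G) m = ([z^ m] (red3 g), [z^ m] (red3 g * red3 f)).
Proof.
move=> f0 /is_riordan_ofE HG; rewrite tnth_mktuple HG // expr0 mulr1.
congr pair; have N_gt0 : (0 < N)%N by apply: leq_ltn_trans (ltn_ord m).
have ord1E : (inord 1 : 'I_N.+1) = 1%N :> nat by rewrite inordK.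
(* At [m = 0] the second entry lies on the diagonal, outside the congruences; both sides vanish
   because f(0) = 0. *)
have [m0 | m_gt0] := posnP m.
  rewrite m0 coef0_fpsM [[z^ 0] (red3 f)]/= f0 mulr0 (_ : inord 1 = lift ord0 m).
    by rewrite mxE !arcs_irr.
  by apply: val_inj; rewrite /= m0.
by rewrite HG ord1E ?expr1 // lift0 ltnS.
Qed.

Lemma first_columns_inj N :
  {in [set G : orgraph N.+1 | `[< is_riordan G >]] &, injective (@first_columns N)}.
Proof.
move=> G H; rewrite !inE => /asboolP[g [f [f0 HG]]].
move=> /asboolP[g' [f' [f'0 HH]]] eqc.
have [K [_ K_uniq]] := riordan_exists_unique N.+1 g f.
(* By uniqueness it suffices that [H] is also the graph of (g, f). *)
rewrite -(K_uniq G HG); apply: K_uniq; apply/is_riordan_ofE => i j lt_ji.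
rewrite ((is_riordan_ofE g' f' H).1 HH i j lt_ji).
have eq_gf m : (m < N)%N -> [z^ m] (red3 g') = [z^ m] (red3 g) /\
    [z^ m] (red3 g' * red3 f') = [z^ m] (red3 g * red3 f).
  move=> lt_mN; have := congr1 (fun t => tnth t (Ordinal lt_mN)) eqc.
  by rewrite !(tnth_first_columns _ _ HG, tnth_first_columns _ _ HH) // => -[].
apply: (@fps_eqmod_riordan _ N) => [m /eq_gf[]|m /eq_gf[]|] //.
(* Since [j < i] excludes row 0, [i.-1 < N]. *)
by case: i lt_ji => -[].
Qed.

Lemma first_columns_imset N :
  @first_columns N @: [set G | `[< is_riordan G >]]
    = [set t : N.-tuple _ | riordan_columns t].
Proof.
apply/setP => t; apply/imsetP/idP => [[G] |]; rewrite !inE.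
  move=> /asboolP[g [f [f0 HG]]] ->.
  rewrite (_ : val _ =
    mkseq (fun m => ([z^ m] (red3 g), [z^ m] (red3 g * red3 f))) N).
    (* If [g] vanishes below [m], only the term [z^m] g f(0) = 0 of the product remains. *)
    apply: riordan_columns_mkseq => m g0; rewrite coef_fpsM big_ord_recr /= subnn.
    rewrite f0 mulr0 addr0 big1 // => l _.
    by have /= -> := g0 l (ltn_ord l); rewrite mul0r.
  apply: (@eq_from_nth _ 0) => [|m]; rewrite size_tuple ?size_mkseq // => lt_mN.
  by rewrite nth_mkseq // -(tnth_first_columns (Ordinal lt_mN) f0 HG) (tnth_nth 0).
move=> /riordan_columnsP[a [b [b0 ab]]].
have [[g gE] [f fE]] := (red3_surj a, red3_surj b).
(* The lift [f] is known to have zero constant term only modulo 3, whereas [is_riordan] asks for 0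
   in the integers. *)
pose f' : {fps int} := Fps (fun k => if k is 0 then 0 else [z^ k] f).
have f'E : red3 f' = b.
  by rewrite -fE; apply: fpsP => -[|k] //=; rewrite -[RHS]/([z^ 0] (red3 f)) fE b0.
have [G [HG _]] := riordan_exists_unique N.+1 g f'.
exists G; first by rewrite inE; apply/asboolP; exists g, f'.
apply: eq_from_tnth => m; rewrite (tnth_first_columns m _ HG) // gE f'E.
by rewrite (tnth_nth 0) ab // size_tuple.
Qed.

Theorem proposition1p1 (n : nat) (hn : (1 <= n)%N) :
  #|[set G : orgraph n | `[< is_riordan G >] ]|%:R
    = (3 ^+ (2 * (n - 1)) + 3) / 4 :> rat.
Proof.
case: n hn => // N _; rewrite subn1 /= -(card_in_imset (@first_columns_inj N)).
have := card_riordan_columns 'F_3 N; rewrite -first_columns_imset card_Fp //.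
move=> /(congr1 (fun m => m%:R : rat)); rewrite natrM !natrD natrX => <-.
by rewrite mulfK.
Qed.
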